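(* The set $\mathcal{N}$ of Nyldon words over $A$ is not a left Lazard set; that is, there is no total order $\prec$ on $\mathcal{N}$ for which $\mathcal{N}$ endowed with $\prec$ is a left Lazard set.
   Context: $A$ is a finite alphabet of cardinality at least $2$ with a total order $<$. $A^*$ (resp. $A^+$) is the set of finite (resp. nonempty finite) words over $A$, $|w|$ is the length of $w$, and $A^{\le n}$ is the set of words of length at most $n$. The lexicographic order $<_{\mathrm{lex}}$ on $A^*$ is the total order given by: $u<_{\mathrm{lex}}v$ if $u$ is a proper prefix of $v$, or there exist letters $i<j$ and a word $p$ such that $pi$ is a prefix of $u$ and $pj$ is a prefix of $v$; $u\le_{\mathrm{lex}}v$ means $u<_{\mathrm{lex}}v$ or $u=v$. Nyldon words are defined recursively on length: every letter (word of length $1$) is Nyldon; a word $w$ of length at least $2$ is Nyldon if and only if there is no sequence $(n_1,\ldots,n_k)$ of Nyldon words with $w=n_1\cdots n_k$, $\max\{|n_1|,\ldots,|n_k|\}<|w|$ and $n_1\le_{\mathrm{lex}}\cdots\le_{\mathrm{lex}}n_k$. The empty word is not Nyldon. A left Lazard set (also called a left Lazard factorization) is a subset $F$ of $A^+$ endowed with a total order $\prec$ such that, for any integer $n\ge1$, if $F\cap A^{\le n}=\{u_1,\ldots,u_k\}$ with $k\ge 1$ and $u_1\prec\cdots\prec u_k$, and if one sets $Y_1=A$ and $Y_{i+1}=u_i^*(Y_i\setminus\{u_i\})=\{u_i^j y: y\in Y_i\setminus\{u_i\},\ j\ge 0\}$ for $i\ge 1$, then (i) $u_i\in Y_i$ for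 every $i\in\{1,\ldots,k\}$, and (ii) $Y_k\cap A^{\le n}=\{u_k\}$. *)

(* Defs.v *)
From mathcomp Require Import all_boot all_order.
From mathcomp Require Import boolp classical_sets.
Set Implicit Arguments. Unset Strict Implicit. Unset Printing Implicit Defensive.
Import Order.TTheory.
Local Open Scope classical_set_scope.

Section Words.
Context {d : Order.disp_t} {A : finOrderType d}.
Implicit Types (u v w : seq A) (F : set (seq A)) (prec : seq A -> seq A -> Prop).

Definition lexle u v : bool := ((u : seqlexi A) <= (v : seqlexi A))%O.

Definition lexlt u v : bool := ((u : seqlexi A) < (v : seqlexi A))%O.

Lemma lexltP u v :
  lexlt u v <->
  (exists2 s, s != [::] & v = u ++ s) \/
  (exists p i j s t, [/\ (i < j)%O, u = p ++ i :: s & v = p ++ j :: t]).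
Proof.
rewrite /lexlt; elim: u v => [|a u IHu] [|b v].
- rewrite ltxx; split=> //; case=> [[[|//]]//|[p [i [j [s [t [_]]]]]]].
  by case: p.
- rewrite ltxi0s; split=> // _; left; by exists (b :: v).
- rewrite ltxis0; split=> //; case=> [[s _ //]|[p [i [j [s [t [_ _]]]]]]].
  by case: p.
rewrite ltxi_cons; case: (ltgtP a b) => [ltab|ltba|<-{b}] /=.
- by split=> // _; right; exists [::], a, b, u, v.
- split=> //; case=> [[s _ [eba]]|[[|c p] [i [j [s [t [ltij [ia _] [jb _]]]]]]]].
  + by rewrite eba ltxx in ltba.
  + by rewrite ia jb ltNge (ltW ltij) in ltba.
  + by rewrite ia jb ltxx in ltba.
split.
- move/IHu => [[s s0 ->]|[p [i [j [s [t [ltij -> ->]]]]]]].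
  + by left; exists s.
  + by right; exists (a :: p), i, j, s, t.
- move=> H; apply/IHu.
  case: H => [[s s0 [->]]|[[|c p] [i [j [s [t [ltij [ia us] [ja vt]]]]]]]].
  + by left; exists s.
  + by rewrite -ia -ja ltxx in ltij.
  + by right; exists p, i, j, s, t.
Qed.

Lemma lexleP u v : lexle u v <-> lexlt u v \/ u = v.
Proof.
rewrite /lexle /lexlt le_eqVlt; split=> [/orP[/eqP|]|[->|->]];
  rewrite ?eqxx ?orbT //; by [right|left].
Qed.

(* The recursion on the length is carried out with fuel [n]; [nyldonE] below
   is the defining equivalence, free of fuel.  *)
Fixpoint nyldon_rec (n : nat) w : Prop :=
  if n is n'.+1 then
    size w = 1 \/
    (2 <= size w /\
     ~ exists ns : seq (seq A),
         [/\ forall m, m \in ns -> nyldon_rec n' m,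
             w = flatten ns,
             \max_(m <- ns) size m < size w
           & sorted lexle ns])
  else False.

Definition nyldon : set (seq A) := [set w | nyldon_rec (size w) w].

Lemma nyldon_rec_fuel n w : size w <= n -> nyldon_rec n w <-> nyldon w.
Proof.
rewrite /nyldon /=.
suff H : forall k n1 n2 w, size w <= k -> size w <= n1 -> size w <= n2 ->
    nyldon_rec n1 w -> nyldon_rec n2 w.
  by move=> wn; split; apply: (H (size w)).
clear n w; elim=> [|k IHk] [|n1] [|n2] w //=.
1-3: by case: w => [|a w] //= _ _ _ [|[]].
move=> wk wn1 wn2 [->|[w2 nw]]; [by left|right; split=> //].
move=> [ns [nsN wE nsw srt]]; apply: nw; exists ns; split=> // m mns.
have mw : size m < size w.
  by apply: leq_ltn_trans nsw; apply: (@leq_bigmax_seq _ ns xpredT size m).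
apply: (IHk n2 n1); last exact: nsN; rewrite -ltnS; exact: leq_trans mw _.
Qed.

Lemma nyldonE w :
  nyldon w <->
  size w = 1 \/
  (2 <= size w /\
   ~ exists ns : seq (seq A),
       [/\ forall m, m \in ns -> nyldon m,
           w = flatten ns,
           \max_(m <- ns) size m < size w
         & sorted lexle ns]).
Proof.
rewrite -(@nyldon_rec_fuel (size w).+1) //=.
have H ns : \max_(m <- ns) size m < size w ->
  (forall m, m \in ns -> nyldon_rec (size w) m) <->
  (forall m, m \in ns -> nyldon m).
  move=> nsw; split=> h m mns; apply/(@nyldon_rec_fuel (size w)) => //;
  try exact: h; apply: leq_trans (ltnW nsw);
  exact: (@leq_bigmax_seq _ ns xpredT size m).
split=> -[->|[w2 nw]]; [by left|right; split=> //|by left|right; split=> //];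
  move=> [ns [nsN wE nsw srt]]; apply: nw; exists ns; split=> //; exact/(H ns).
Qed.

Definition words_le (n : nat) : set (seq A) := [set w | size w <= n].

Definition strict_total_order_on F prec : Prop :=
  [/\ forall u, F u -> ~ prec u u,
      forall u v w, F u -> F v -> F w -> prec u v -> prec v w -> prec u w
    & forall u v, F u -> F v -> u <> v -> prec u v \/ prec v u].

(* [lazardY us i] is the set Y_(i+1) associated with u_1, ..., u_k, where
   u_(i+1) is [nth [::] us i].  *)
Fixpoint lazardY (us : seq (seq A)) (i : nat) : set (seq A) :=
  if i is i'.+1 then
    let u := nth [::] us i' in
    [set w | exists j y,
       (lazardY us i' `\ u) y /\ w = flatten (nseq j u) ++ y]
  else [set w | size w = 1].

Definition left_Lazard F prec : Prop :=
  [/\ F `<=` [set w | w != [::]],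
      strict_total_order_on F prec
    & forall (n : nat) (us : seq (seq A)),
        1 <= n -> us != [::] ->
        F `&` words_le n = [set` us] ->
        (forall i, i.+1 < size us -> prec (nth [::] us i) (nth [::] us i.+1)) ->
        (forall i, i < size us -> lazardY us i (nth [::] us i)) /\
        lazardY us (size us).-1 `&` words_le n =
          [set nth [::] us (size us).-1]].

End Words.

Arguments nyldon {d} A.

(* Main.v *)
Require Import Defs.
From mathcomp Require Import all_boot all_order.
From mathcomp Require Import boolp classical_sets.

(** Left elimination of a first letter [c] from the alphabet creates every word
    [c^j d] with [d] a letter other than [c].  A word created by the elimination
    can only disappear by being eliminated itself, and every eliminated word, as
    well as the single short word that remains at the end, lies in the set [F].
    Hence a left Lazard set that contains the letters contains, for each length
    bound, the words [c^j d] within that bound for some letter [c]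
    ([left_Lazard_first_letter]).

    Nyldon words already violate this at length 3, whatever [c] is.  Take a
    letter [d] other than [c].  If [c < d], then [cd] is the nondecreasing product
    of the letters [c] and [d], so it is not Nyldon.  If [d < c], then [cd] is
    Nyldon, and [c] is a prefix of it, so [ccd] is the nondecreasing product of
    [c] and [cd] and is not Nyldon. *)

Set Implicit Arguments.
Unset Strict Implicit.
Unset Printing Implicit Defensive.
Import Order.TTheory.
Local Open Scope classical_set_scope.

Section LeftLazard.
Context {d : Order.disp_t} {A : finOrderType d}.
Implicit Types (u v w : seq A) (F : set (seq A)) (prec : seq A -> seq A -> Prop).

Lemma enum_words_le F n :
  exists2 s : seq (seq A), uniq s & F `&` words_le n = [set` s].
Proof.
pose all_words := flatten [seq [seq val t | t : k.-tuple A] | k <- iota 0 n.+1].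
exists (undup [seq w <- all_words | `[< F w >]]); first exact: undup_uniq.
apply/seteqP; split=> w /=; rewrite mem_undup mem_filter.
  move=> [Fw wn]; apply/andP; split; first exact/asboolP.
  apply/flatten_mapP; exists (size w); first by rewrite mem_iota.
  by apply/fintype.imageP; exists (in_tuple w).
move=> /andP[/asboolP Fw /flatten_mapP[k]]; rewrite mem_iota /= ltnS => kn.
by move=> /fintype.imageP[t _ wt]; split=> //; rewrite /words_le /= wt size_tuple.
Qed.

(** Sorting needs a total boolean relation, so the strict order is completed by
    equality; the enumeration has no duplicates, so consecutive entries are
    strictly increasing again. *)
Lemma strict_sorted_enum F prec n : strict_total_order_on F prec ->
  exists2 us : seq (seq A), F `&` words_le n = [set` us] &
    forall i, i.+1 < size us -> prec (nth [::] us i) (nth [::] us i.+1).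
Proof.
move=> [_ _ tot]; have [s s_uniq sE] := enum_words_le F n.
pose leT := [rel u v | (u == v) || `[< prec u v >]].
have leT_total : {in F &, total leT}.
  move=> u v /set_mem Fu /set_mem Fv /=; rewrite [v == u]eq_sym.
  have [->//|/eqP uv] := eqVneq u v.
  by case: (tot _ _ Fu Fv uv) => /asboolP ->; rewrite ?orbT.
have sF : all (mem F) s.
  by apply/allP => u us; apply/mem_set; have [] : (F `&` words_le n) u by rewrite sE.
exists (sort leT s); first by rewrite sE; apply/seteqP; split=> u /=; rewrite mem_sort.
move=> i ltis; have /sortedP-/(_ [::] i ltis) /= := sort_sorted_in leT_total sF.
by rewrite nth_uniq ?sort_uniq // ?(ltnW ltis) // -[i == _]negbK neq_ltn ltnSn /= => /asboolP.
Qed.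

(** The exponent [j = 0] keeps every word other than the eliminated one. *)
Lemma lazardY_persist us w i k : w \notin us -> i <= k < size us ->
  lazardY us i w -> lazardY us k w.
Proof.
move=> wus /andP[]; elim: k => [|k IHk]; first by rewrite leqn0 => /eqP->.
rewrite leq_eqVlt => /predU1P[->//|leik] ltk Yw.
exists 0, w; split=> //; split; first exact: IHk (ltnW ltk) Yw.
by move=> /= wE; case/negP: wus; rewrite wE mem_nth // ltnW.
Qed.

Lemma lazardY_subset F prec n us i : left_Lazard F prec ->
  0 < n -> F `&` words_le n = [set` us] ->
  (forall k, k.+1 < size us -> prec (nth [::] us k) (nth [::] us k.+1)) ->
  i < size us -> lazardY us i `&` words_le n `<=` F.
Proof.
move=> [_ _ lazF] n0 usE us_sorted ltiu w [Yw wn].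
have us0 : us != [::] by rewrite -size_eq0 -lt0n (leq_ltn_trans _ ltiu).
have usF u : u \in us -> F u.
  by move=> uus; have [] : (F `&` words_le n) u by rewrite usE.
have [/usF//|wus] := boolP (w \in us).
have [_ YE] := lazF n us n0 us0 usE us_sorted.
have : (lazardY us (size us).-1 `&` words_le n) w.
  split=> //; apply: (lazardY_persist wus) Yw.
  by case: (us) ltiu => //= u us' ltiu; rewrite leqnn andbT.
by rewrite YE /= => ->; apply/usF/mem_nth; case: (us) us0.
Qed.

(** [c] is the [prec]-least element of [F] of length at most [n]: elimination
    starts from the alphabet, so the first eliminated word has to be a letter. *)
Lemma left_Lazard_first_letter F prec n : 1 < #|A| -> 0 < n ->
  left_Lazard F prec -> (forall a, F [:: a]) ->
  exists c, forall a j, a != c -> j < n -> F (nseq j c ++ [:: a]).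
Proof.
move=> A2 n0 lazF lettersF; have [_ precP lazP] := lazF.
have [us usE us_sorted] := strict_sorted_enum n precP.
have letter_us a : [:: a] \in us.
  by have : (F `&` words_le n) [:: a] by []; rewrite usE.
have [a0 _] : exists a0 : A, a0 \in A by apply/card_gt0P/ltnW.
have us0 : us != [::] by apply: contraTneq (letter_us a0) => ->.
have [/(_ 0) Y0 _] := lazP n us n0 us0 usE us_sorted.
have [c u0E] : exists c, nth [::] us 0 = [:: c].
  have : size (nth [::] us 0) = 1 by apply: Y0; rewrite lt0n size_eq0.
  by case: (nth [::] us 0) => [|c []] // _; exists c.
exists c => a j ac jn; apply: (lazardY_subset lazF n0 usE us_sorted (i := 1)).
  (* [us] has at least two entries: the distinct letters [a] and [c]. *)
  have := uniq_leq_size (s1 := [:: [:: a]; [:: c]]) (s2 := us).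
  rewrite /= inE eqseq_cons (negPf ac); apply=> // u.
  by rewrite !inE => /orP[]/eqP->.
split; last by rewrite /words_le /= size_cat size_nseq addn1.
exists j, [:: a]; split; last by rewrite u0E; congr (_ ++ _); elim: (j) => //= k <-.
by split=> //; rewrite u0E => -[/eqP]; rewrite (negPf ac).
Qed.

End LeftLazard.

Section Nyldon.
Context {d : Order.disp_t} {A : finOrderType d}.
Implicit Types (a c : A) (u v w : seq A).

Lemma nyldon_letter a : nyldon A [:: a].
Proof. by apply/nyldonE; left. Qed.

Lemma nyldon_neq0 w : nyldon A w -> w != [::].
Proof. by case: w => // /nyldonE[//|[]]. Qed.

Lemma nyldon_catN u v : nyldon A u -> nyldon A v -> lexle u v ->
  ~ nyldon A (u ++ v).
Proof.
move=> Nu Nv uv /nyldonE; rewrite size_cat.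
have := nyldon_neq0 Nu; have := nyldon_neq0 Nv; rewrite -!size_eq0 -!lt0n => v0 u0.
case=> [|[_]]; first by case: (size u) (size v) u0 v0 => [|m] [|n] //; rewrite addnS.
apply; exists [:: u; v]; split=> /=.
- by move=> w; rewrite !inE => /orP[]/eqP->.
- by rewrite cats0.
- by rewrite !big_cons big_nil maxn0 gtn_max -{1}[size u]addn0 ltn_add2l v0 -{1}[size v]add0n ltn_add2r.
- by rewrite uv.
Qed.

Lemma nyldon_pair a c : (a < c)%O -> nyldon A [:: c; a].
Proof.
move=> ac; apply/nyldonE; right; split=> // -[ns [nsN caE ns_lt ns_le]].
have {nsN} : all (fun w => w != [::]) ns by apply/allP => w /nsN/nyldon_neq0.
(* Factors of [ca] shorter than [ca] are nonempty, so they are [c] and [a]. *)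
case: ns caE ns_lt ns_le => [//|u [|v ns]] /=.
  by rewrite cats0 big_seq1 => <-.
case: u => [|b [|b' u]]; case: v => [|e v] //=; rewrite ?andbF //.
- by move=> [<- <- _] _; rewrite /lexle lexi_cons leNgt ac.
- by move=> [_ _]; case: u.
Qed.

End Nyldon.

Theorem proposition55 (d : Order.disp_t) (A : finOrderType d) :
  1 < #|A| ->
  ~ exists prec : seq A -> seq A -> Prop, left_Lazard (nyldon A) prec.
Proof.
move=> A2 [prec lazN].
have [c cN] := left_Lazard_first_letter (n := 3) A2 isT lazN (@nyldon_letter _ _).
have [a ac] : exists a, a != c.
  have [a [b [_ _ ab]]] := card_gt1P A2.
  by have [ac|ac] := eqVneq a c; [exists b; rewrite -ac eq_sym | exists a].
have [lt_ac|lt_ca|eq_ac] := ltgtP a c; last by rewrite eq_ac eqxx in ac.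
- apply: (nyldon_catN (nyldon_letter c) (nyldon_pair lt_ac)); last exact: (cN a 2).
  by apply/lexleP; left; apply/lexltP; left; exists [:: a].
- apply: (nyldon_catN (nyldon_letter c) (nyldon_letter a)); last exact: (cN a 1).
  by rewrite /lexle lexi_cons (ltW lt_ca) lexx implybT.
Qed.
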